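(* Let $b_n$ be the number of freely-braided hexagon-avoiding permutations in $S_n$ and let $m_n$ be the number of maximally-clustered hexagon-avoiding permutations in $S_n$. Then for all $n\ge 9$, $$b_{n+1}=6b_n-9b_{n-1}+3b_{n-2}+b_{n-3}-8b_{n-4}-b_{n-5}+b_{n-6}$$ and $$m_{n+1}=7m_n-15m_{n-1}+14m_{n-2}-8m_{n-3}-4m_{n-4}+3m_{n-5},$$ with initial conditions $$(b_3,b_4,\dots,b_9)=(6,20,71,260,971,3670,13968),\qquad (m_3,m_4,\dots,m_9)=(6,21,78,298,1157,4535,17872).$$
   Context: All avoidance is classical (one-line notation) permutation pattern avoidance. A permutation is freely braided if it avoids $[4231],[3421],[4312],[4321]$; it is maximally clustered if it avoids $[3421],[4312],[4321]$. Hexagon-avoiding permutations are those avoiding $[46718235],[46781235],[56718234],[56781234]$. Thus ''freely-braided hexagon-avoiding'' (respectively ''maximally-clustered hexagon-avoiding'') means avoiding all patterns of both lists. *)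

(* Defs.v *)
From mathcomp Require Import all_boot all_fingroup.

Set Implicit Arguments.
Unset Strict Implicit.
Unset Printing Implicit Defensive.

Local Open Scope nat_scope.

(* A pattern is given by its one-line notation, e.g. [4231] is
   [:: 4; 2; 3; 1].  A permutation w : 'S_n acts on {0, ..., n-1}; only the
   relative order of the values matters, so the shift with respect to
   {1, ..., n} is irrelevant.  [f] lists the positions of an occurrence. *)
Definition occurrence n (p : seq nat) (w : 'S_n)
    (f : {ffun 'I_(size p) -> 'I_n}) : bool :=
  [forall i : 'I_(size p), forall j : 'I_(size p),
      (i < j) ==> (f i < f j)] &&
  [forall i : 'I_(size p), forall j : 'I_(size p),
      (w (f i) < w (f j)) == (nth 0 p i < nth 0 p j)].

Definition contains n (p : seq nat) (w : 'S_n) : bool :=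
  [exists f : {ffun 'I_(size p) -> 'I_n}, occurrence w f].

Definition avoids n (p : seq nat) (w : 'S_n) : bool := ~~ contains p w.

Definition freely_braided n (w : 'S_n) : bool :=
  [&& avoids [:: 4; 2; 3; 1] w, avoids [:: 3; 4; 2; 1] w,
      avoids [:: 4; 3; 1; 2] w & avoids [:: 4; 3; 2; 1] w].

Definition maximally_clustered n (w : 'S_n) : bool :=
  [&& avoids [:: 3; 4; 2; 1] w, avoids [:: 4; 3; 1; 2] w
    & avoids [:: 4; 3; 2; 1] w].

Definition hexagon_avoiding n (w : 'S_n) : bool :=
  [&& avoids [:: 4; 6; 7; 1; 8; 2; 3; 5] w,
      avoids [:: 4; 6; 7; 8; 1; 2; 3; 5] w,
      avoids [:: 5; 6; 7; 1; 8; 2; 3; 4] w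
    & avoids [:: 5; 6; 7; 8; 1; 2; 3; 4] w].

Definition num_fb_hex (n : nat) : nat :=
  #|[set w : 'S_n | freely_braided w && hexagon_avoiding w]|.

Definition num_mc_hex (n : nat) : nat :=
  #|[set w : 'S_n | maximally_clustered w && hexagon_avoiding w]|.

(* Main.v *)
(* Call [i] an excedance of [w] if [i < w i] and a deficiency if [w i < i].  At a
   cut [k] as many [i < k] satisfy [k <= w i] as [i >= k] satisfy [w i < k]; call
   this number the height at [k].  A permutation is maximally clustered iff it
   is increasing on its excedances, increasing on its deficiencies, and all its
   fixed points have height at most 1.  It is then determined by the word whose
   [k]-th letter compares [k] with [w k] and with [w^-1 k]; these words are
   Motzkin paths with two kinds of level steps and the fixed points as a third
   kind.  The remaining patterns become local conditions on the path: 4231 occurs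
   iff there are two consecutive fixed points at height 1, and a hexagon occurs
   iff the path reaches height 4 or contains, starting at height 3, a down step
   followed by an up step or two level steps of different kinds.  Hence the words
   form a regular language, counted by a finite linear system. *)
From Stdlib Require BinNat Nnat.
Require Import Defs.
From mathcomp Require Import all_boot all_order all_fingroup all_algebra.
From mathcomp Require Import zify.
Import GRing.Theory.
Set Implicit Arguments.
Unset Strict Implicit.
Unset Printing Implicit Defensive.
Local Open Scope nat_scope.

(** * Counting along words *)

Fixpoint cnt (p : pred nat) (k : nat) : nat :=
  if k is k'.+1 then cnt p k' + p k' else 0.

Lemma cnt_mono (p : pred nat) j k : j <= k -> cnt p j <= cnt p k.
Proof.
elim: k => [|k IH]; first by rewrite leqn0 => /eqP->.
by rewrite leq_eqVlt ltnS => /orP[/eqP->//|/IH] /=; lia.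
Qed.

Lemma cnt_lt (p : pred nat) j k : j < k -> p j -> cnt p j < cnt p k.
Proof. by move=> /(cnt_mono p) /= + pj; rewrite pj; lia. Qed.

(** Lets an index be recovered from its rank among the indices satisfying [p]; this is how values
    are read off a word. *)
Lemma cnt_inj (p : pred nat) j k : p j -> p k -> cnt p j = cnt p k -> j = k.
Proof.
move=> pj pk E; case: (ltngtP j k) => // /(@cnt_lt p) => [/(_ pj)|/(_ pk)];
  by rewrite E ltnn.
Qed.

Lemma cnt_lt_le (p : pred nat) j k : p j -> cnt p j < cnt p k -> j < k.
Proof. by move=> pj; apply: contraTltn => /(cnt_mono p); rewrite -leqNgt. Qed.

Lemma cnt_exists (p : pred nat) n j : j < cnt p n -> exists2 k, k < n & p k /\ cnt p k = j.
Proof.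
elim: n => //= n IH; case: (ltnP j (cnt p n)) => [/IH[k kn Hk] _|h1 h2].
  by exists k => //; apply: leqW.
by exists n => //; move: h1 h2; case: (p n) => /=; lia.
Qed.

Lemma cnt_card n (p : pred nat) (k : nat) : k <= n ->
  cnt p k = #|[set i : 'I_n | (i < k) && p i]|.
Proof.
move=> kn; have -> : cnt p k = \sum_(i < k) p i.
  elim: k {kn} => [|k IH] /=; first by rewrite big_ord0.
  by rewrite big_ord_recr /= IH.
rewrite (big_ord_widen n (fun i => p i : nat) kn) -sum1dep_card.
by rewrite [RHS]big_mkcondr; apply: eq_bigr => i _; case: (p i).
Qed.

(* [None] is a fixed point; [Some (o, p)] records at index [k] whether the
   position [k] is an excedance ([o], "open") or a deficiency ("low"), and whether
   the value [k] sits after position [k] ([p], "pending") or before ("placed"). *)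
Definition letter : Type := option (bool * bool).

Definition opn (a : letter) := if a is Some (o, _) then o else false.
Definition low (a : letter) := if a is Some (o, _) then ~~ o else false.
Definition pnd (a : letter) := if a is Some (_, p) then p else false.
Definition plc (a : letter) := if a is Some (_, p) then ~~ p else false.

Definition lcnt (f : letter -> bool) (s : seq letter) : nat -> nat :=
  cnt (fun i => f (nth None s i)).

(** Each letter other than [None] types its position once, as [opn] or [low], and its value once, as
    [plc] or [pnd]. *)
Lemma lcnt_balance s k : lcnt opn s k + lcnt low s k = lcnt plc s k + lcnt pnd s k.
Proof.
by elim: k => //= k IH; rewrite /lcnt /= in IH *; case: (nth _ _ _) => [[[] []]|] /=; lia.
Qed.

(* [lu] and [ll] are the level steps; on [lu] an excedance both starts and ends. *)
Definition up : letter := Some (true, true).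
Definition dn : letter := Some (false, false).
Definition lu : letter := Some (true, false).
Definition ll : letter := Some (false, true).

Definition hstep (h : nat) (a : letter) : nat :=
  match a with Some (true, true) => h.+1 | Some (false, false) => h.-1 | _ => h end.

(* [p] is the letter before [a] and [h] the height before [a]; the flag [fb]
   switches on the avoidance of 4231. *)
Definition ok (fb : bool) (h : nat) (p a : letter) : bool :=
  match a with
  | None => (h <= 1) && ~~ [&& fb, h == 1 & p == None]
  | Some (true, true) => (h <= 2) && ~~ ((h == 2) && (p == dn))
  | Some (false, false) => 0 < h
  | Some (true, false) => (0 < h) && ~~ ((h == 3) && (p == ll))
  | Some (false, true) => (0 < h) && ~~ ((h == 3) && (p == lu))
  end.

Fixpoint run (fb : bool) (h : nat) (p : letter) (s : seq letter) : bool :=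
  if s is a :: s' then ok fb h p a && run fb (hstep h a) a s' else h == 0.

Definition hgt (h : nat) (s : seq letter) (k : nat) : nat := foldl hstep h (take k s).

(** Entry [k] of [p :: s] is the letter preceding entry [k] of [s], so acceptance becomes a
    condition at each index. *)
Lemma runP fb h p s :
  reflect ((forall k, k < size s ->
              ok fb (hgt h s k) (nth None (p :: s) k) (nth None s k))
           /\ hgt h s (size s) = 0)
          (run fb h p s).
Proof.
elim: s h p => [|a s IH] h p /=.
  by apply: (iffP eqP) => [->|[_]] //.
apply: (iffP andP) => [[oka /IH[Ho He]]|[Ho He]].
  by split=> // -[|k] //= /Ho.
split; first exact: (Ho 0).
by apply/IH; split=> // k ks; apply: (Ho k.+1).
Qed.

Lemma hgtS h s k : k < size s -> hgt h s k.+1 = hstep (hgt h s k) (nth None s k).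
Proof. by move=> ks; rewrite /hgt (take_nth None ks) -cats1 foldl_cat. Qed.

(** * The word of a permutation *)

(** Functions on [nat] let the positions of an occurrence be named [g 0], [g 1] and so on. *)
Lemma containsP n (p : seq nat) (w : 'S_n) : 0 < size p ->
  reflect (exists g : nat -> 'I_n,
             (forall i j, i < j -> j < size p -> g i < g j) /\
             (forall i j, i < size p -> j < size p ->
                (w (g i) < w (g j)) = (nth 0 p i < nth 0 p j)))
          (contains p w).
Proof.
move=> p0; apply: (iffP existsP) => [[f /andP[/'forall_'forall_implyP H1 /'forall_'forall_eqP H2]]|[g [H1 H2]]].
  exists (fun i => f (insubd (Ordinal p0) i)); split=> [i j ij jp|i j ip jp].
    by apply: H1; rewrite !val_insubd jp (ltn_trans ij jp).
  by rewrite H2 !val_insubd ip jp.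
exists [ffun i : 'I_(size p) => g i]; apply/andP; split.
  by apply/'forall_'forall_implyP => i j ij; rewrite !ffunE H1.
by apply/'forall_'forall_eqP => i j; rewrite !ffunE H2.
Qed.

Lemma card_chain n (A : {set 'I_n}) k : 0 < k <= #|A| ->
  exists2 g : nat -> 'I_n, (forall i j, i < j -> j < k -> g i < g j)
                         & forall i, i < k -> g i \in A.
Proof.
case/andP=> k0 kA.
have /card_gt0P[x0 _] : 0 < #|A| by apply: leq_trans kA.
have sA : sorted (fun i j : 'I_n => i < j) (enum A).
  rewrite /enum_mem; apply: sorted_filter; first by move=> y x z; apply: ltn_trans.
  have := iota_ltn_sorted 0 n; rewrite -val_enum_ord sorted_map.
  by rewrite -enumT.
exists (nth x0 (enum A)) => [i j ij jk|i ik].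
  have jA : j < size (enum A) by rewrite -cardE (leq_trans jk).
  by apply: (sorted_ltn_nth _ x0 sA) => //; [exact: ltn_trans|rewrite inE (ltn_trans ij)].
by rewrite -mem_enum mem_nth // -cardE (leq_trans ik).
Qed.

Definition ltr n (w : 'S_n) (k : 'I_n) : letter :=
  if w k == k then None else Some (k < w k, k < (w^-1)%g k).

Definition word n (w : 'S_n) : seq letter := [seq ltr w k | k <- enum 'I_n].

Lemma size_word n (w : 'S_n) : size (word w) = n.
Proof. by rewrite size_map size_enum_ord. Qed.

Lemma nth_word n (w : 'S_n) (k : 'I_n) : nth None (word w) k = ltr w k.
Proof. by rewrite (nth_map k) ?size_enum_ord // nth_ord_enum. Qed.

Lemma opn_ltr n (w : 'S_n) k : opn (ltr w k) = (k < w k).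
Proof. by rewrite /ltr; case: eqP => [->|] //=; rewrite ltnn. Qed.

Lemma low_ltr n (w : 'S_n) k : low (ltr w k) = (w k < k).
Proof.
rewrite /ltr; case: eqP => [->|/eqP] /=; first by rewrite ltnn.
by rewrite -val_eqE /=; case: ltngtP.
Qed.

Lemma fix_inv n (w : 'S_n) k : (w k == k) = ((w^-1)%g k == k).
Proof. by rewrite -(inj_eq (@perm_inj _ w^-1)%g) permK eq_sym. Qed.

Lemma pnd_ltr n (w : 'S_n) k : pnd (ltr w k) = (k < (w^-1)%g k).
Proof. by rewrite /ltr fix_inv; case: eqP => [->|] //=; rewrite ltnn. Qed.

Lemma plc_ltr n (w : 'S_n) k : plc (ltr w k) = ((w^-1)%g k < k).
Proof.
rewrite /ltr fix_inv; case: eqP => [->|/eqP] /=; first by rewrite ltnn.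
by rewrite -val_eqE /=; case: ltngtP.
Qed.

(** * Height as the number of crossings of a cut *)

Definition upper n (w : 'S_n) (k : nat) : {set 'I_n} := [set i : 'I_n | i < k <= w i].
Definition lower n (w : 'S_n) (k : nat) : {set 'I_n} := [set i : 'I_n | w i < k <= i].

Lemma lcnt_card n (w : 'S_n) f k : k <= n ->
  lcnt f (word w) k = #|[set i : 'I_n | (i < k) && f (ltr w i)]|.
Proof.
move=> kn; rewrite /lcnt (cnt_card _ kn).
by apply: eq_card => i; rewrite !inE nth_word.
Qed.

Lemma lcnt_opn n (w : 'S_n) k : k <= n ->
  lcnt opn (word w) k = #|[set i : 'I_n | (i < k) && (i < w i)]|.
Proof. by move/lcnt_card->; apply: eq_card => i; rewrite !inE opn_ltr. Qed.

Lemma lcnt_low n (w : 'S_n) k : k <= n ->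
  lcnt low (word w) k = #|[set i : 'I_n | (i < k) && (w i < i)]|.
Proof. by move/lcnt_card->; apply: eq_card => i; rewrite !inE low_ltr. Qed.

(** Letters are indexed by values on the left and by positions on the right; [w] carries the second
    set onto the first. *)
Lemma lcnt_plc n (w : 'S_n) k : k <= n ->
  lcnt plc (word w) k = #|[set i : 'I_n | (w i < k) && (i < w i)]|.
Proof.
move/lcnt_card->; rewrite -[RHS](card_imset _ (@perm_inj _ w)).
apply: eq_card => i; rewrite -[in RHS](permKV w i) mem_imset; last exact: perm_inj.
by rewrite !inE plc_ltr permKV.
Qed.

Lemma lcnt_pnd n (w : 'S_n) k : k <= n ->
  lcnt pnd (word w) k = #|[set i : 'I_n | (w i < k) && (w i < i)]|.
Proof.
move/lcnt_card->; rewrite -[RHS](card_imset _ (@perm_inj _ w)).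
apply: eq_card => i; rewrite -[in RHS](permKV w i) mem_imset; last exact: perm_inj.
by rewrite !inE pnd_ltr permKV.
Qed.

(** Excedances at positions below [k] either have their value below [k] too or cross the cut. *)
Lemma card_upper n (w : 'S_n) k : k <= n ->
  lcnt opn (word w) k = lcnt plc (word w) k + #|upper w k|.
Proof.
move=> kn; rewrite lcnt_opn // lcnt_plc // -(cardsID [set i : 'I_n | w i < k]).
by congr (_ + _); apply: eq_card => i; rewrite !inE; lia.
Qed.

Lemma card_lower n (w : 'S_n) k : k <= n ->
  lcnt pnd (word w) k = lcnt low (word w) k + #|lower w k|.
Proof.
move=> kn; rewrite lcnt_pnd // lcnt_low // -(cardsID [set i : 'I_n | i < k]).
by congr (_ + _); apply: eq_card => i; rewrite !inE; lia.
Qed.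

Lemma card_upper_lower n (w : 'S_n) k : k <= n -> #|upper w k| = #|lower w k|.
Proof.
by move=> kn; move: (card_upper w kn) (card_lower w kn) (lcnt_balance (word w) k); lia.
Qed.

Lemma hgt_upper n (w : 'S_n) k : k <= n -> hgt 0 (word w) k = #|upper w k|.
Proof.
move=> kn; suff: lcnt opn (word w) k = lcnt plc (word w) k + hgt 0 (word w) k.
  by move: (card_upper w kn); lia.
elim: k kn => [|k IH] kn; first by rewrite /hgt take0.
rewrite hgtS ?size_word //.
(* The crossing count at [k.+1] rules out a down step from height 0, where the predecessor in
   [hstep] would truncate. *)
have := IH (ltnW kn); have := card_upper w kn.
rewrite /lcnt /=; case: (nth _ _ _) => [[[] []]|] /=; lia.
Qed.

(** * Monotonicity on excedances and on deficiencies *)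

Definition inc_exc n (w : 'S_n) : bool :=
  [forall i : 'I_n, forall j : 'I_n, [&& i < w i, j < w j & i < j] ==> (w i < w j)].
Definition inc_def n (w : 'S_n) : bool :=
  [forall i : 'I_n, forall j : 'I_n, [&& w i < i, w j < j & i < j] ==> (w i < w j)].

Lemma inc_excP n (w : 'S_n) :
  reflect (forall i j : 'I_n, i < w i -> j < w j -> i < j -> w i < w j) (inc_exc w).
Proof.
apply: (iffP 'forall_'forall_implyP) => H i j; last by case/and3P; apply: H.
by move=> h1 h2 h3; apply: H; rewrite h1 h2.
Qed.

Lemma inc_defP n (w : 'S_n) :
  reflect (forall i j : 'I_n, w i < i -> w j < j -> i < j -> w i < w j) (inc_def w).
Proof.
apply: (iffP 'forall_'forall_implyP) => H i j; last by case/and3P; apply: H.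
by move=> h1 h2 h3; apply: H; rewrite h1 h2.
Qed.

(** When [w] is increasing on excedances, [k] has the same rank among their positions as [w k] among
    their values. *)
Lemma lcnt_exc n (w : 'S_n) (k : 'I_n) : inc_exc w -> k < w k ->
  lcnt plc (word w) (w k) = lcnt opn (word w) k.
Proof.
move=> /inc_excP H kw; rewrite lcnt_plc ?lcnt_opn 1?ltnW //.
apply: eq_card => i; rewrite !inE.
case: (ltnP i (w i)) => // iw; rewrite ?andbF ?andbT //.
case: (ltngtP i k) => [/(H i k iw kw) //|/(H k i kw iw)|/ord_inj->]; lia.
Qed.

Lemma lcnt_def n (w : 'S_n) (k : 'I_n) : inc_def w -> w k < k ->
  lcnt pnd (word w) (w k) = lcnt low (word w) k.
Proof.
move=> /inc_defP H kw; rewrite lcnt_pnd ?lcnt_low 1?ltnW //.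
apply: eq_card => i; rewrite !inE.
case: (ltnP (w i) i) => // iw; rewrite ?andbF ?andbT //.
case: (ltngtP i k) => [/(H i k iw kw) //|/(H k i kw iw)|/ord_inj->]; lia.
Qed.

(** * Maximally clustered permutations *)

Lemma neq_val n (w : 'S_n) (i j : 'I_n) : i < j -> w i <> w j :> nat.
Proof. by move=> ij /ord_inj/perm_inj E; rewrite E ltnn in ij. Qed.

Lemma contains4P n (p0 p1 p2 p3 : nat) (w : 'S_n) :
  uniq [:: p0; p1; p2; p3] ->
  reflect (exists a b c d : 'I_n, a < b /\ b < c /\ c < d /\
             (w a < w b) = (p0 < p1) /\ (w a < w c) = (p0 < p2) /\
             (w a < w d) = (p0 < p3) /\ (w b < w c) = (p1 < p2) /\
             (w b < w d) = (p1 < p3) /\ (w c < w d) = (p2 < p3))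
          (contains [:: p0; p1; p2; p3] w).
Proof.
move=> up; apply: (iffP (containsP w _)) => //.
  move=> [g [H1 H2]]; exists (g 0), (g 1), (g 2), (g 3).
  by rewrite !H1 // !H2.
move=> [a [b [c [d [ab [bc [cd [h1 [h2 [h3 [h4 [h5 h6]]]]]]]]]]]].
exists (nth a [:: a; b; c; d]); split.
  by move=> [|[|[|[|i]]]] [|[|[|[|j]]]] //=; lia.
have nab := neq_val (w := w) ab; have nbc := neq_val (w := w) bc; have ncd := neq_val (w := w) cd.
have nac := neq_val (w := w) (ltn_trans ab bc); have nbd := neq_val (w := w) (ltn_trans bc cd).
have nad := neq_val (w := w) (ltn_trans ab (ltn_trans bc cd)).
move: up; rewrite /= !inE => up.
by move=> [|[|[|[|i]]]] [|[|[|[|j]]]] //= _ _; lia.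
Qed.

Lemma upper_pair n (w : 'S_n) k : 1 < #|upper w k| ->
  exists a b : 'I_n, [/\ a < b, b < k, k <= w a & k <= w b].
Proof.
move=> h; case: (@card_chain n (upper w k) 2) => // g Hm Hi.
by exists (g 0), (g 1); have := Hi 1 isT; have := Hi 0 isT; have := Hm 0 1 isT isT; rewrite !inE; split; lia.
Qed.

Lemma lower_pair n (w : 'S_n) k : 1 < #|lower w k| ->
  exists a b : 'I_n, [/\ a < b, k <= a, w a < k & w b < k].
Proof.
move=> h; case: (@card_chain n (lower w k) 2) => // g Hm Hi.
by exists (g 0), (g 1); have := Hi 1 isT; have := Hi 0 isT; have := Hm 0 1 isT isT; rewrite !inE; split; lia.
Qed.

Lemma card_gt1_ord n (A : {set 'I_n}) (a b : 'I_n) : a \in A -> b \in A ->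
  a < b -> 1 < #|A|.
Proof.
move=> aA bA ab; apply/card_gt1P; exists a, b; split=> //.
by apply: contraTneq ab => ->; rewrite ltnn.
Qed.

(** If [b] were an excedance, so would be [a], and the two would form a descent; if it were a
    deficiency, the same holds with [c]. *)
Lemma mid321_fix n (w : 'S_n) (a b c : 'I_n) : inc_exc w -> inc_def w ->
  a < b -> b < c -> w b < w a -> w c < w b -> w b = b :> nat.
Proof.
move=> /inc_excP He /inc_defP Hd ab bc wba wcb.
case: (ltngtP b (w b)) => // h; last first.
  by have := Hd b c; lia.
by have := He a b; lia.
Qed.

Definition low_fix n (w : 'S_n) : bool :=
  [forall k : 'I_n, (w k == k) ==> (#|upper w k| <= 1)].

(** A descent of excedances, a descent of deficiencies or a fixed point at height 2 sits at a cut
    crossed twice in each direction, and suitable crossings complete a forbidden pattern.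
    Conversely, the middle of a 321 inside a forbidden pattern is fixed: in 3421 and 4312 its height
    is at least 2, in 4321 two fixed points would be out of order. *)
Lemma maximally_clusteredE n (w : 'S_n) :
  maximally_clustered w = [&& inc_exc w, inc_def w & low_fix w].
Proof.
rewrite /maximally_clustered /avoids.
apply/and3P/and3P => [[/contains4P H1 /contains4P H2 /contains4P H3]|[He Hd /'forall_implyP Hf]].
  have {}H1 := H1 isT; have {}H2 := H2 isT; have {}H3 := H3 isT.
  split.
  - apply/inc_excP => a b aw bw ab; case: (ltnP (w a) (w b)) => // wab.
    have := neq_val (w := w) ab => nab.
    have : 1 < #|upper w b.+1|.
      by apply: (@card_gt1_ord _ _ a b); rewrite ?inE; lia.
    rewrite card_upper_lower // => /lower_pair[c [d [cd bc wc wd]]].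
    have := neq_val (w := w) cd => ncd.
    case: (ltnP (w c) (w d)) => wcd.
      by case: H2; exists a, b, c, d; lia.
    by case: H3; exists a, b, c, d; lia.
  - apply/inc_defP => c d wc wd cd; case: (ltnP (w c) (w d)) => // wcd.
    have := neq_val (w := w) cd => ncd.
    have : 1 < #|lower w c|.
      by apply: (@card_gt1_ord _ _ c d); rewrite ?inE; lia.
    rewrite -card_upper_lower; last exact: ltnW.
    move=> /upper_pair[a [b [ab bc wa wb]]].
    have := neq_val (w := w) ab => nab.
    case: (ltnP (w a) (w b)) => wab.
      by case: H1; exists a, b, c, d; lia.
    by case: H3; exists a, b, c, d; lia.
  - apply/'forall_implyP => k /eqP wk; rewrite leqNgt; apply/negP => h.
    have [a [b [ab bk wa wb]]] := upper_pair h.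
    move: h; rewrite card_upper_lower; last exact: ltnW.
    move=> /lower_pair[c [d [cd kc wc wd]]].
    have := neq_val (w := w) ab => nab.
    have ak : w a <> w k :> nat by apply: neq_val; lia.
    have bk' : w b <> w k :> nat by apply: neq_val; lia.
    rewrite wk in ak bk'.
    have wkk : w k = k :> nat by rewrite wk.
    case: (ltnP (w a) (w b)) => wab.
      by case: H1; exists a, b, k, d; lia.
    by case: H3; exists a, b, k, d; lia.
split; apply/contains4P => // -[a [b [c [d [ab [bc [cd [/= h1 [h2 [h3 [h4 [h5 h6]]]]]]]]]]]];
 have nab := neq_val (w := w) ab; have nbc := neq_val (w := w) bc; have ncd := neq_val (w := w) cd;
 have nac := neq_val (w := w) (ltn_trans ab bc); have nbd := neq_val (w := w) (ltn_trans bc cd).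
- have := @mid321_fix _ w b c d He Hd bc cd; rewrite ltnNge leq_eqVlt => wc.
  have {}wc : w c = c :> nat by apply: wc; lia.
  have := Hf c; rewrite -val_eqE /= wc eqxx => /(_ isT).
  rewrite leqNgt => /negP[]; apply: (@card_gt1_ord _ _ a b) => //; rewrite !inE; lia.
- have wb : w b = b :> nat by apply: (@mid321_fix _ w a b c); lia.
  have := Hf b; rewrite -val_eqE /= wb eqxx => /(_ isT).
  rewrite card_upper_lower; last exact: ltnW.
  rewrite leqNgt => /negP[]; apply: (@card_gt1_ord _ _ c d) => //; rewrite !inE; lia.
- have wb : w b = b :> nat by apply: (@mid321_fix _ w a b c); lia.
  have wc : w c = c :> nat by apply: (@mid321_fix _ w b c d); lia.
  lia.
Qed.

(** * Hexagons and 4231 *)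

(** Here [s] need not come from a permutation: [ok] itself forbids a down step at height 0 and an up
    step from height 3. *)
Lemma ok_cnt fb s :
  (forall k, k < size s -> ok fb (hgt 0 s k) (nth None (None :: s) k) (nth None s k)) ->
  forall k, k <= size s ->
    [/\ lcnt opn s k = lcnt plc s k + hgt 0 s k,
        lcnt pnd s k = lcnt low s k + hgt 0 s k & hgt 0 s k <= 3].
Proof.
move=> Hok k ks; suff [h1 h2] :
    lcnt opn s k = lcnt plc s k + hgt 0 s k /\ hgt 0 s k <= 3.
  by move: (lcnt_balance s k); split=> //; lia.
elim: k ks => [|k IH] ks; first by rewrite /hgt take0.
have := IH (ltnW ks); have := Hok k ks; rewrite hgtS // /lcnt /=.
by case: (nth None s k) => [[[] []]|] /= Ho [E h3]; split; move: Ho; lia.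
Qed.

(* Consider the first [k] with [i < lcnt plc s k.+1] or [l < lcnt low s k.+1]: the
   height at [k] is 3, and whichever letter occurs at [k], every possible next
   letter is excluded by [ok] or by the hypotheses. *)
Lemma ok_no_hexagon fb s i l K :
  (forall k, k < size s -> ok fb (hgt 0 s k) (nth None (None :: s) k) (nth None s k)) ->
  hgt 0 s (size s) = 0 ->
  (forall k, low (nth None s k) -> lcnt low s k = l -> i + 3 <= lcnt opn s k) ->
  (forall k, low (nth None s k) -> lcnt low s k = l.+1 -> i + 4 <= lcnt opn s k) ->
  (forall k, plc (nth None s k) -> lcnt plc s k = i -> l + 3 <= lcnt pnd s k) ->
  (forall k, plc (nth None s k) -> lcnt plc s k = i.+1 -> l + 4 <= lcnt pnd s k) ->
  K <= size s -> lcnt low s K <= l.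
Proof.
move=> Hok H0 T1 T2 T3 T4 Ks; rewrite leqNgt; apply/negP => lK.
have ex : exists K, (i < lcnt plc s K) || (l < lcnt low s K).
  by exists K; rewrite lK orbT.
case: (ex_minnP ex) => -[|k] // Hk Hmin.
have ks : k < size s by apply: leq_trans Ks; apply: Hmin; rewrite lK orbT.
have Hk' : ~~ ((i < lcnt plc s k) || (l < lcnt low s k)).
  by apply/negP => /Hmin; rewrite ltnn.
have [c1 c2 c3] := ok_cnt Hok (ltnW ks).
(* [T1] and [T3] at [k] force height 3; [T2] and [T4] at [k.+1] exclude the next letters that [ok]
   leaves. *)
have := T1 k; have := T3 k; have := T2 k.+1; have := T4 k.+1.
have := Hok k ks; have hS := hgtS 0 ks.
(* The path ends at height 0, so a positive height guarantees a next letter. *)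
have h0 : 0 < hgt 0 s k.+1 -> k.+1 < size s.
  by move=> h; rewrite ltn_neqAle ks andbT; apply: contraTneq h => ->; rewrite H0.
move: Hk; rewrite /lcnt /= in Hk' c1 c2 *.
case E: (nth None s k) hS => [[[] []]|] /= hS; rewrite ?addn1 ?addn0.
(* The cases are [up], [lu], [ll], [dn], [None]; the first and the last change neither count,
   against the choice of [k]. *)
- lia.
- move=> Hk Ho t4 t2 t3 t1; have {}h0 : k.+1 < size s by apply: h0; move: Ho t3; lia.
  have /= := Hok _ h0; rewrite hS E.
  by case E': (nth None s k.+1) t2 t4 => [[[] []]|] //= t2 t4; rewrite ?eqxx ?andbT; move: Ho t3; lia.
- move=> Hk Ho t4 t2 t3 t1; have {}h0 : k.+1 < size s by apply: h0; move: Ho t1; lia.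
  have /= := Hok _ h0; rewrite hS E.
  by case E': (nth None s k.+1) t2 t4 => [[[] []]|] //= t2 t4; rewrite ?eqxx ?andbT; move: Ho t1; lia.
- move=> Hk Ho t4 t2 t3 t1; have {}h0 : k.+1 < size s by apply: h0; move: Ho t1 t3; lia.
  have /= := Hok _ h0; rewrite hS E.
  by case E': (nth None s k.+1) t2 t4 => [[[] []]|] //= t2 t4; rewrite ?eqxx ?andbT; move: Ho t1 t3; lia.
- lia.
Qed.

Lemma ok_hexagon_avoiding fb n (w : 'S_n) (e0 e1 e2 e3 d0 d1 d2 d3 : 'I_n) :
  run fb 0 None (word w) -> inc_exc w -> inc_def w -> low_fix w ->
  [/\ e0 < e1, e1 < e2, e2 < e3 & e2 < d0] ->
  [/\ e3 < d1, d0 < d1, d1 < d2 & d2 < d3] ->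
  [/\ w d0 < w d1, w d1 < w d2, w d2 < w d3 & w d2 < w e0] ->
  [/\ w d3 < w e1, w e0 < w e1, w e1 < w e2 & w e2 < w e3] -> False.
Proof.
move=> /runP[Hok H0] He Hd Hf [p1 p2 p3 p4] [p5 p6 p7 p8] [v1 v2 v3 v4] [v5 v6 v7 v8].
(* An entry exceeding two later ones is an excedance: a deficiency would form a descent with [c], a
   fixed point would have height 2. Dually for [def]. *)
have exc (a c d : 'I_n) : a < c -> c < d -> w c < w a -> w d < w a -> a < w a.
  move=> ac cd wc wd; case: (ltngtP a (w a)) => // h.
    by move/inc_defP: Hd => /(_ a c); lia.
  move/'forall_implyP: Hf => /(_ a); rewrite -val_eqE /= -h eqxx => /(_ isT).
  rewrite card_upper_lower; last exact: ltnW.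
  by rewrite leqNgt => /negP[]; apply: (@card_gt1_ord _ _ c d) => //; rewrite !inE; lia.
have def (a b d : 'I_n) : a < b -> b < d -> w d < w a -> w d < w b -> w d < d.
  move=> ab bd wa wb; case: (ltngtP d (w d)) => // h.
    by move/inc_excP: He => /(_ b d); lia.
  move/'forall_implyP: Hf => /(_ d); rewrite -val_eqE /= -h eqxx => /(_ isT).
  by rewrite leqNgt => /negP[]; apply: (@card_gt1_ord _ _ a b) => //; rewrite !inE; lia.
have E0 : e0 < w e0 by apply: (exc e0 d0 d1); lia.
have E1 : e1 < w e1 by apply: (exc e1 d0 d1); lia.
have E2 : e2 < w e2 by apply: (exc e2 d0 d1); lia.
have E3 : e3 < w e3 by apply: (exc e3 d1 d2); lia.
have D0 : w d0 < d0 by apply: (def e0 e1 d0); lia.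
have D1 : w d1 < d1 by apply: (def e0 e1 d1); lia.
have D2 : w d2 < d2 by apply: (def e0 e1 d2); lia.
have D3 : w d3 < d3 by apply: (def e1 e2 d3); lia.
have op (a : 'I_n) : a < w a -> opn (nth None (word w) a) by rewrite nth_word opn_ltr.
have lo (a : 'I_n) : w a < a -> low (nth None (word w) a) by rewrite nth_word low_ltr.
have pl (a : 'I_n) : a < w a -> plc (nth None (word w) (w a)).
  by rewrite nth_word plc_ltr permK.
have pn (a : 'I_n) : w a < a -> pnd (nth None (word w) (w a)).
  by rewrite nth_word pnd_ltr permK.
set s := word w in Hok H0 op lo pl pn *.
pose i := lcnt opn s e0; pose l := lcnt low s d0.
pose P := lcnt opn s; pose Q := lcnt plc s; pose R := lcnt pnd s; pose S := lcnt low s.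
have Pe01 : P e0 < P e1 by apply: cnt_lt => //; exact: op.
have Pe12 : P e1 < P e2 by apply: cnt_lt => //; exact: op.
have Pe23 : P e2 < P e3 by apply: cnt_lt => //; exact: op.
have Sd01 : S d0 < S d1 by apply: cnt_lt => //; exact: lo.
have Qe01 : Q (w e0) < Q (w e1) by apply: cnt_lt => //; exact: pl.
have Rd12 : R (w d1) < R (w d2) by apply: cnt_lt => //; exact: pn.
have Rd23 : R (w d2) < R (w d3) by apply: cnt_lt => //; exact: pn.
have QP : Q (w e1) = P e1 by apply: lcnt_exc.
have RS : R (w d1) = S d1 by apply: lcnt_def.
have mon (f : letter -> bool) (j k : nat) : j < k -> f (nth None s j) -> lcnt f s j < lcnt f s k.
  by move=> jk fj; apply: cnt_lt.
suff : S d1 <= (S d1).-1 by move: Sd01; lia.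
(* The ranks of [e1] and [d1], lowered by one, serve as thresholds. The four bounds come from
   comparing [k] with [d0], [d1], [w e0] and [w e1] in turn. *)
apply: (@ok_no_hexagon fb s (P e1).-1) => //.
- move=> k lk Sk.
  have d0k : d0 <= k.
    rewrite leqNgt; apply/negP => /(mon low) /(_ lk); rewrite -/S in Sk *; lia.
  have : P e2 < P k by apply: mon; [lia|exact: op].
  rewrite -/P; lia.
- move=> k lk Sk.
  have d1k : d1 <= k.
    rewrite leqNgt; apply/negP => /(mon low) /(_ lk); rewrite -/S in Sk *; lia.
  have : P e3 < P k by apply: mon; [lia|exact: op].
  rewrite -/P; lia.
- move=> k lk Qk.
  have e0k : w e0 <= k.
    rewrite leqNgt; apply/negP => /(mon plc) /(_ lk); rewrite -/Q in Qk *; lia.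
  have : R (w d2) < R k by apply: mon; [lia|exact: pn].
  rewrite -/R; lia.
- move=> k lk Qk.
  have e1k : w e1 <= k.
    rewrite leqNgt; apply/negP => /(mon plc) /(_ lk); rewrite -/Q in Qk *; lia.
  have : R (w d3) < R k by apply: mon; [lia|exact: pn].
  rewrite -/R; lia.
- by rewrite size_word ltnW.
Qed.

(* The four hexagons differ only by the relative positions of [e3], [d0] (the
   values 8 and 1) and the relative values of [e0], [d3] (the values 4 and 5). *)
Lemma hexagonP n (w : 'S_n) :
  reflect (exists e0 e1 e2 e3 d0 d1 d2 d3 : 'I_n,
             [/\ [/\ e0 < e1, e1 < e2, e2 < e3 & e2 < d0],
                 [/\ e3 < d1, d0 < d1, d1 < d2 & d2 < d3],
                 [/\ w d0 < w d1, w d1 < w d2, w d2 < w d3 & w d2 < w e0] &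
                 [/\ w d3 < w e1, w e0 < w e1, w e1 < w e2 & w e2 < w e3]])
          (~~ hexagon_avoiding w).
Proof.
rewrite /hexagon_avoiding /avoids !negb_and !negbK; apply: (iffP or4P).
  case=> /containsP[//|g [H1 H2]].
  - exists (g 0), (g 1), (g 2), (g 4), (g 3), (g 5), (g 6), (g 7).
    by split; split; rewrite ?H1 ?H2.
  - exists (g 0), (g 1), (g 2), (g 3), (g 4), (g 5), (g 6), (g 7).
    by split; split; rewrite ?H1 ?H2.
  - exists (g 0), (g 1), (g 2), (g 4), (g 3), (g 5), (g 6), (g 7).
    by split; split; rewrite ?H1 ?H2.
  - exists (g 0), (g 1), (g 2), (g 3), (g 4), (g 5), (g 6), (g 7).
    by split; split; rewrite ?H1 ?H2.
move=> [e0 [e1 [e2 [e3 [d0 [d1 [d2 [d3 [[p1 p2 p3 p4] [p5 p6 p7 p8] [v1 v2 v3 v4] [v5 v6 v7 v8]]]]]]]]]].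
have ne : w e0 <> w d3 :> nat by apply: neq_val; lia.
have [pe|pe|/ord_inj pe] := ltngtP d0 e3; last by subst e3; lia.
  have [ve|ve] := ltnP (w e0) (w d3).
    constructor 1; apply/containsP => //; exists (nth e0 [:: e0; e1; e2; d0; e3; d1; d2; d3]); split.
    by move=> [|[|[|[|[|[|[|[|i]]]]]]]] [|[|[|[|[|[|[|[|j]]]]]]]] //= _ _; lia.
  by move=> [|[|[|[|[|[|[|[|i]]]]]]]] [|[|[|[|[|[|[|[|j]]]]]]]] //= _ _; lia.
  constructor 3; apply/containsP => //; exists (nth e0 [:: e0; e1; e2; d0; e3; d1; d2; d3]); split.
    by move=> [|[|[|[|[|[|[|[|i]]]]]]]] [|[|[|[|[|[|[|[|j]]]]]]]] //= _ _; lia.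
  by move=> [|[|[|[|[|[|[|[|i]]]]]]]] [|[|[|[|[|[|[|[|j]]]]]]]] //= _ _; lia.
have [ve|ve] := ltnP (w e0) (w d3).
  constructor 2; apply/containsP => //; exists (nth e0 [:: e0; e1; e2; e3; d0; d1; d2; d3]); split.
    by move=> [|[|[|[|[|[|[|[|i]]]]]]]] [|[|[|[|[|[|[|[|j]]]]]]]] //= _ _; lia.
  by move=> [|[|[|[|[|[|[|[|i]]]]]]]] [|[|[|[|[|[|[|[|j]]]]]]]] //= _ _; lia.
  constructor 4; apply/containsP => //; exists (nth e0 [:: e0; e1; e2; e3; d0; d1; d2; d3]); split.
    by move=> [|[|[|[|[|[|[|[|i]]]]]]]] [|[|[|[|[|[|[|[|j]]]]]]]] //= _ _; lia.
  by move=> [|[|[|[|[|[|[|[|i]]]]]]]] [|[|[|[|[|[|[|[|j]]]]]]]] //= _ _; lia.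
Qed.

(** The middle entries [b] and [c] are fixed, so the height there is at most 1. As [a] and [d]
    already cross both cuts, no excedance or deficiency can start or end in between, yet [ok]
    requires a letter other than [None] right after [b]. *)
Lemma run_avoids4231 n (w : 'S_n) :
  run true 0 None (word w) -> inc_exc w -> inc_def w ->
  avoids [:: 4; 2; 3; 1] w.
Proof.
move=> /runP[Hok H0] He Hd; apply/contains4P => //.
move=> [a [b [c [d [ab [bc [cd [/= h1 [h2 [h3 [h4 [h5 h6]]]]]]]]]]]].
have nab := neq_val (w := w) ab; have nac := neq_val (w := w) (ltn_trans ab bc).
have ncd := neq_val (w := w) cd; have nbd := neq_val (w := w) (ltn_trans bc cd).
have wb : w b = b by apply/ord_inj/(@mid321_fix _ w a b d); lia.
have wc : w c = c by apply/ord_inj/(@mid321_fix _ w a c d); lia.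
rewrite wb wc in h1 h2 h3 h4 h5 h6 nab nac ncd nbd.
have wa : a < w a by lia.
have wd : w d < d by lia.
have Pa : lcnt opn (word w) a < lcnt opn (word w) b.
  by apply: cnt_lt => //; rewrite nth_word opn_ltr.
have Rd : lcnt pnd (word w) (w d) < lcnt pnd (word w) b.
  by apply: cnt_lt; [lia|rewrite nth_word pnd_ltr permK].
have Qa := lcnt_exc He wa; have Sd := lcnt_def Hd wd.
have Qc : lcnt plc (word w) c <= lcnt plc (word w) (w a) by apply: cnt_mono; lia.
have Sc : lcnt low (word w) c <= lcnt low (word w) d by apply: cnt_mono; lia.
have [b1 b2 _] := ok_cnt Hok (k := b) ltac:(rewrite size_word ltnW //).
have [c1 c2 _] := ok_cnt Hok (k := c) ltac:(rewrite size_word ltnW //).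
have xb : nth None (word w) b = None by rewrite nth_word /ltr wb eqxx.
have xc : nth None (word w) c = None by rewrite nth_word /ltr wc eqxx.
have := Hok b; rewrite size_word ltn_ord xb => /(_ isT) /andP[hb _].
have := Hok c; rewrite size_word ltn_ord xc => /(_ isT) /andP[hc _].
have bn : b.+1 < n by apply: leq_ltn_trans (ltn_ord c).
have hS : hgt 0 (word w) b.+1 = hgt 0 (word w) b by rewrite hgtS ?size_word // xb.
have Qbc : lcnt plc (word w) b <= lcnt plc (word w) c by apply/cnt_mono/ltnW.
have hb1 : hgt 0 (word w) b = 1 by lia.
have := Hok b.+1; rewrite size_word bn /= hS xb hb1 => /(_ isT).
case E: (nth None (word w) b.+1) => [[o p]|] // _.
have {}bc : b.+1 < c.
  by rewrite ltn_neqAle bc andbT; apply: contra_eqN E => /eqP->; rewrite xc.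
have mon (f : letter -> bool) : lcnt f (word w) b + f (Some (o, p)) <= lcnt f (word w) c.
  apply: leq_trans (cnt_mono _ bc); rewrite /= E leq_add2r.
  exact: leq_addr.
move: (mon opn) (mon plc) (mon low); clear -b1 c1 c2 Qc Qa Pa Sc Rd Sd b2 hb1 hc Qbc.
by case: o p => [] [] /=; lia.
Qed.

(** Three crossings in each direction give all but two entries; [x] is the last excedance and [z]
    the last deficiency of the hexagon. *)
Lemma contains_hexagon n (w : 'S_n) c (x z : 'I_n) :
  inc_exc w -> inc_def w -> c <= n -> 3 <= #|upper w c| ->
  x < w x -> w z < z -> c <= x <= c.+1 -> c <= w z <= c.+1 ->
  ~~ hexagon_avoiding w.
Proof.
move=> /inc_excP He /inc_defP Hd cn hc wx wz /andP[cx xc] /andP[cz zc].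
have hc' : 3 <= #|lower w c| by rewrite -card_upper_lower.
have [g Hg Ug] := card_chain (k := 3) (A := upper w c) hc.
have [d Hd' Ld] := card_chain (k := 3) (A := lower w c) hc'.
have := Hg 0 1 isT isT; have := Hg 1 2 isT isT; have := Hd' 0 1 isT isT; have := Hd' 1 2 isT isT.
have := Ug 0 isT; have := Ug 1 isT; have := Ug 2 isT.
have := Ld 0 isT; have := Ld 1 isT; have := Ld 2 isT.
rewrite !inE.
move: (g 0) (g 1) (g 2) (d 0) (d 1) (d 2) => g0 g1 g2 d0 d1 d2 D2 D1 D0 G2 G1 G0 d12 d01 g12 g01.
have wg01 : w g0 < w g1 by apply: He; lia.
have wg12 : w g1 < w g2 by apply: He; lia.
have wg2x : w g2 < w x by apply: He; lia.
have wd01 : w d0 < w d1 by apply: Hd; lia.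
have wd12 : w d1 < w d2 by apply: Hd; lia.
have d2z : d2 < z.
  case: (ltngtP d2 z) => // [h|/ord_inj h]; last by subst z; lia.
  by have := Hd z d2 wz _ h; lia.
(* Both are within reach of [c.+1], from below and from above, and an excedance is not a deficiency;
   [wzg1] is the same for values. *)
have xd1 : x < d1.
  have : x <> d1 :> nat by move=> h; have {}h := ord_inj h; subst d1; lia.
  lia.
have wzg1 : w z < w g1.
  have : w z <> w g1 :> nat.
    by move=> h; have {}h := perm_inj (ord_inj h); subst g1; lia.
  lia.
apply/hexagonP; exists g0, g1, g2, x, d0, d1, d2, z.
by split; split; lia.
Qed.

(** The eight crossings themselves form 56781234. *)
Lemma contains_hexagon4 n (w : 'S_n) c :
  inc_exc w -> inc_def w -> c <= n -> 4 <= #|upper w c| ->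
  ~~ hexagon_avoiding w.
Proof.
move=> /inc_excP He /inc_defP Hd cn hc.
have hc' : 4 <= #|lower w c| by rewrite -card_upper_lower.
have [g Hg Ug] := card_chain (k := 4) (A := upper w c) hc.
have [d Hd' Ld] := card_chain (k := 4) (A := lower w c) hc'.
have := Hg 0 1 isT isT; have := Hg 1 2 isT isT; have := Hg 2 3 isT isT.
have := Hd' 0 1 isT isT; have := Hd' 1 2 isT isT; have := Hd' 2 3 isT isT.
have := Ug 0 isT; have := Ug 1 isT; have := Ug 2 isT; have := Ug 3 isT.
have := Ld 0 isT; have := Ld 1 isT; have := Ld 2 isT; have := Ld 3 isT.
rewrite !inE.
move: (g 0) (g 1) (g 2) (g 3) (d 0) (d 1) (d 2) (d 3).
move=> g0 g1 g2 g3 d0 d1 d2 d3 D3 D2 D1 D0 G3 G2 G1 G0 d23 d12 d01 g23 g12 g01.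
have wg01 : w g0 < w g1 by apply: He; lia.
have wg12 : w g1 < w g2 by apply: He; lia.
have wg23 : w g2 < w g3 by apply: He; lia.
have wd01 : w d0 < w d1 by apply: Hd; lia.
have wd12 : w d1 < w d2 by apply: Hd; lia.
have wd23 : w d2 < w d3 by apply: Hd; lia.
apply/hexagonP; exists g0, g1, g2, g3, d0, d1, d2, d3.
by split; split; lia.
Qed.

Lemma ltr_Some n (w : 'S_n) k o p : ltr w k = Some (o, p) ->
  [/\ (k < w k) = o, (w k < k) = ~~ o,
      (k < (w^-1)%g k) = p & ((w^-1)%g k < k) = ~~ p].
Proof. by move=> E; rewrite -opn_ltr -low_ltr -pnd_ltr -plc_ltr E. Qed.

Lemma run_word fb n (w : 'S_n) : inc_exc w -> inc_def w ->
  run fb 0 None (word w) =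
  [&& low_fix w, fb ==> avoids [:: 4; 2; 3; 1] w & hexagon_avoiding w].
Proof.
move=> He Hd; apply/idP/and3P => [Hr|[/'forall_implyP Hf Hfb Hh]].
  have Hf : low_fix w.
    apply/'forall_implyP => k /eqP wk.
    have /runP[/(_ k) + _] := Hr; rewrite size_word ltn_ord nth_word /ltr wk eqxx.
    by move=> /(_ isT) /andP[+ _]; rewrite hgt_upper // ltnW.
  split=> //; first by apply/implyP => fbT; rewrite fbT in Hr; exact: run_avoids4231.
  apply/negPn/negP => /hexagonP[e0 [e1 [e2 [e3 [d0 [d1 [d2 [d3 [p q u v]]]]]]]]].
  exact: (ok_hexagon_avoiding Hr He Hd Hf p q u v).
apply/runP; rewrite size_word; split; last first.
  rewrite hgt_upper //; apply/eqP; rewrite cards_eq0 -subset0; apply/subsetP => i.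
  by rewrite !inE; have := ltn_ord (w i); lia.
move=> k kn; pose j := Ordinal kn; rewrite hgt_upper 1?ltnW //.
rewrite (nth_word w j : nth None (word w) k = _).
have prevP a : nth None (None :: word w) k = Some a ->
    exists2 i : 'I_n, k = i.+1 & ltr w i = Some a.
  case: k kn @j => // k kn _ /= E; exists (Ordinal (ltnW kn)) => //.
  by rewrite -nth_word.
have cu : 3 < #|upper w k.+1| -> False.
  by move=> h; move: Hh; apply/negP; apply: contains_hexagon4 h.
case E: (ltr w j) => [[o p]|] /=; last first.
  have wj : w j = j by move: E; rewrite /ltr; case: eqP. clear E.
  have -> /= : #|upper w k| <= 1 by have := Hf j; rewrite wj eqxx => /(_ isT).
  apply/negP => /and3P[fbT /eqP h1 /eqP prev].
  rewrite fbT /= in Hfb.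
  case: k kn @j prevP cu wj h1 prev => [|k] kn j prevP cu wj h1 prev.
    (* At [k = 0] the preceding letter is the initial [None], but nothing crosses the cut 0. *)
    by have /eqP/cards1P[i /setP/(_ i)] := h1; rewrite !inE eqxx.
  pose i := Ordinal (ltnW kn).
  have wi : w i = i.
    by move: prev; rewrite /= (nth_word w i : nth None (word w) k = _) /ltr; case: eqP.
  (* The excedance and the deficiency crossing between the two fixed points complete a 4231. *)
  have /card_gt0P[a] : 0 < #|upper w k.+1| by rewrite h1.
  have /card_gt0P[d] : 0 < #|lower w k.+1| by rewrite -card_upper_lower ?h1 // ltnW.
  rewrite !inE => dl au.
  have aj : w a <> j :> nat by rewrite -wj => /ord_inj/perm_inj aj; move: au; rewrite aj /=; lia.
  have ai : a <> i :> nat by move=> /ord_inj ai; move: au; rewrite ai wi /=; lia.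
  have di : w d <> i :> nat by rewrite -wi => /ord_inj/perm_inj di; move: dl; rewrite di /=; lia.
  have dj : d <> j :> nat by move=> /ord_inj dj; move: dl; rewrite dj wj /=; lia.
  move/negP: Hfb; apply; apply/contains4P => //; exists a, i, j, d.
  by rewrite wi wj; move: aj ai di dj au dl; rewrite /=; lia.
have [wj1 wj2 wj3 wj4] := ltr_Some E.
have hnext (i : 'I_n) : #|upper w i.+1| = hstep #|upper w i| (ltr w i).
  rewrite -(hgt_upper w (ltn_ord i)) -(hgt_upper w (ltnW (ltn_ord i))).
  by rewrite hgtS ?size_word // nth_word.
have hex (i x z : 'I_n) : #|upper w i| = 3 -> x < w x -> w z < z ->
    i <= x <= i.+1 -> i <= w z <= i.+1 -> False.
  move=> hi wx wz xi zi; move: Hh; apply/negP.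
  by apply: (@contains_hexagon _ w i x z) => //; [exact: ltnW|rewrite hi].
have upos : (w^-1)%g j < j -> 0 < #|upper w k|.
  by move=> h; apply/card_gt0P; exists (w^-1 j)%g; rewrite inE h permKV leqnn.
have lpos : w j < j -> 0 < #|upper w k|.
  move=> h; rewrite card_upper_lower; last exact: ltnW.
  by apply/card_gt0P; exists j; rewrite inE h leqnn.
have := hnext j; rewrite E.
case: o p E wj1 wj2 wj3 wj4 => [] [] E /= wj1 wj2 wj3 wj4 hS.
(* In each forbidden pair of letters the cut [i] has height 3; [x] is the open index among [i] and
   [j], and [w z] the pending one. *)
- apply/andP; split; first by rewrite leqNgt; apply/negP => h; apply: cu; rewrite hS.
  apply/negP => /andP[/eqP h2 /eqP /prevP[i ki Ei]].
  have [wi1 wi2 wi3 wi4] := ltr_Some Ei.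
  have := hnext i; rewrite -ki h2 Ei /= => hi.
  by apply: (hex i j (w^-1 j)%g); rewrite ?permKV //=; lia.
- rewrite upos //=; apply/negP => /andP[/eqP h2 /eqP /prevP[i ki Ei]].
  have [wi1 wi2 wi3 wi4] := ltr_Some Ei.
  have := hnext i; rewrite -ki h2 Ei /= => hi.
  by apply: (hex i j (w^-1 i)%g); rewrite ?permKV //=; lia.
- rewrite lpos //=; apply/negP => /andP[/eqP h2 /eqP /prevP[i ki Ei]].
  have [wi1 wi2 wi3 wi4] := ltr_Some Ei.
  have := hnext i; rewrite -ki h2 Ei /= => hi.
  by apply: (hex i i (w^-1 j)%g); rewrite ?permKV //=; lia.
- exact: lpos.
Qed.

(** * Permutations and words *)

(** The letter reveals a fixed point; elsewhere [w k] is the placed or pending index whose rank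
    equals that of [k] among the open or low ones. *)
Lemma word_inj n (w w' : 'S_n) : inc_exc w -> inc_def w -> inc_exc w' -> inc_def w' ->
  word w = word w' -> w = w'.
Proof.
move=> He Hd He' Hd' E; apply/permP => k; apply: ord_inj.
have Ek : ltr w k = ltr w' k by rewrite -!nth_word E.
case F: (ltr w k) Ek => [[o p]|] /esym F'; last first.
  by move: F F'; rewrite /ltr; do 2![case: eqP => // ->].
have [h1 h2 h3 h4] := ltr_Some F; have [h1' h2' h3' h4'] := ltr_Some F'.
case: o {F F'} h1 h2 h1' h2' => /= h1 h2 h1' h2'.
  apply: (@cnt_inj (fun i => plc (nth None (word w) i))).
  - by rewrite nth_word plc_ltr permK.
  - by rewrite E nth_word plc_ltr permK.
  - by have := lcnt_exc He' h1'; rewrite -E -(lcnt_exc He h1).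
apply: (@cnt_inj (fun i => pnd (nth None (word w) i))).
- by rewrite nth_word pnd_ltr permK.
- by rewrite E nth_word pnd_ltr permK.
- by have := lcnt_def Hd' h2'; rewrite -E -(lcnt_def Hd h2).
Qed.

(** The inverse construction sends the open positions to the placed values, and the low positions to
    the pending values, in increasing order. *)
Lemma word_surj fb n (s : seq letter) : size s = n -> run fb 0 None s ->
  exists w : 'S_n, [/\ inc_exc w, inc_def w & word w = s].
Proof.
move=> sn /runP[Hok H0]; rewrite sn in Hok H0; pose x := nth None s.
have C k : k <= n -> [/\ lcnt opn s k = lcnt plc s k + hgt 0 s k,
        lcnt pnd s k = lcnt low s k + hgt 0 s k & hgt 0 s k <= 3].
  by move=> kn; apply: (ok_cnt (fb := fb)); rewrite sn.
(* Final height 0 makes open and placed letters equally many, and likewise low and pending ones. *)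
have [Pn Rn _] := C n (leqnn n); rewrite H0 !addn0 in Pn Rn.
pose img (k v : 'I_n) := match x k with
  | None => v = k
  | Some (true, _) => plc (x v) /\ lcnt plc s v = lcnt opn s k
  | Some (false, _) => pnd (x v) /\ lcnt pnd s v = lcnt low s k
  end.
have /fin_all_exists[f Hf] (k : 'I_n) : exists v, img k v.
  rewrite /img; case E: (x k) => [[[] p]|]; last by exists k.
    have : lcnt opn s k < lcnt plc s n by rewrite -Pn; apply: cnt_lt => //; rewrite -/x E.
    by case/cnt_exists => v vn Hv; exists (Ordinal vn).
  have : lcnt low s k < lcnt pnd s n by rewrite Rn; apply: cnt_lt => //; rewrite -/x E.
  by case/cnt_exists => v vn Hv; exists (Ordinal vn).
have fP (k : 'I_n) : opn (x k) -> plc (x (f k)) /\ lcnt plc s (f k) = lcnt opn s k.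
  by have := Hf k; rewrite /img; case: (x k) => [[[] p]|].
have fS (k : 'I_n) : low (x k) -> pnd (x (f k)) /\ lcnt pnd s (f k) = lcnt low s k.
  by have := Hf k; rewrite /img; case: (x k) => [[[] p]|].
have f0 (k : 'I_n) : x k = None -> f k = k by have := Hf k; rewrite /img => + E; rewrite E.
have tri (k : 'I_n) : [\/ x k = None, opn (x k) | low (x k)].
  by case: (x k) => [[[] p]|]; [constructor 2|constructor 3|constructor 1].
have xplc a : plc a -> ~~ pnd a /\ a <> None by case: a => [[o []]|].
have xpnd a : pnd a -> a <> None by case: a => [[o []]|].
have finj : injective f.
  move=> i j E; have := fP i; have := fP j; have := fS i; have := fS j.
  have := f0 i; have := f0 j; rewrite E.
  case: (tri i) => Ei; case: (tri j) => Ej f0j f0i fSj fSi fPj fPi.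
  - by rewrite -(f0i Ei) (f0j Ej).
  - by have [/xplc[_ []]] := fPj Ej; rewrite (f0i Ei).
  - by have [/xpnd[]] := fSj Ej; rewrite (f0i Ei).
  - by have [/xplc[_ []]] := fPi Ei; rewrite (f0j Ej).
  - apply: ord_inj; apply: (@cnt_inj (fun i => opn (x i))) => //.
    by have [_ A] := fPi Ei; have [_ B] := fPj Ej; exact: etrans (esym A) B.
  - by have [/xplc[/negP[]]] := fPi Ei; case: (fSj Ej).
  - by have [/xpnd[]] := fSi Ei; rewrite (f0j Ej).
  - by have [/xplc[/negP[]]] := fPj Ej; case: (fSi Ei).
  - apply: ord_inj; apply: (@cnt_inj (fun i => low (x i))) => //.
    by have [_ A] := fSi Ei; have [_ B] := fSj Ej; exact: etrans (esym A) B.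
pose w := perm finj.
have wE k : w k = f k by rewrite permE.
have pos (v : 'I_n) a : x v = Some a -> plc (x v) \/ low (x v) -> 0 < hgt 0 s v.
  by have := Hok v (ltn_ord v); rewrite -/x => + E; rewrite E; case: a {E} => [[] []] /= + [] // _; lia.
(* If [f k <= k], the open count at [f k] is at most that at [k], which equals the placed count at
   [f k]; positive height at [f k] contradicts this. *)
have wexc (k : 'I_n) : opn (x k) -> k < w k.
  move=> ok; have [pf Qf] := fP k ok; rewrite wE ltnNge; apply/negP => fk.
  have hf : 0 < hgt 0 s (f k).
    case E: (x (f k)) pf => [a|] // pf; apply: (pos _ _ E); left; by rewrite E.
  have [c _ _] := C (f k) (ltnW (ltn_ord _)).
  have : lcnt opn s (f k) <= lcnt opn s k by apply: cnt_mono.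
  by lia.
have wdef (k : 'I_n) : low (x k) -> w k < k.
  move=> lk; have [pf Rf] := fS k lk; rewrite wE ltnNge; apply/negP => fk.
  have hf : 0 < hgt 0 s k.
    case E: (x k) lk => [a|] // lk; apply: (pos _ _ E); right; by rewrite E.
  have [_ c _] := C k (ltnW (ltn_ord _)).
  have : lcnt pnd s k <= lcnt pnd s (f k) by apply: cnt_mono.
  by lia.
have excx (k : 'I_n) : k < w k -> opn (x k).
  case: (tri k) => // [/f0|/wdef]; last by lia.
  by rewrite -wE => ->; rewrite ltnn.
have defx (k : 'I_n) : w k < k -> low (x k).
  case: (tri k) => // [/f0|/wexc]; last by lia.
  by rewrite -wE => ->; rewrite ltnn.
exists w; split.
- apply/inc_excP => i j /excx oi /excx oj ij; rewrite !wE.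
  have [pi Qi] := fP i oi; have [pj Qj] := fP j oj.
  apply: (@cnt_lt_le (fun k => plc (x k)) _ _ pi); rewrite [X in X < _]Qi [X in _ < X]Qj.
  exact: (@cnt_lt (fun k => opn (x k))).
- apply/inc_defP => i j /defx oi /defx oj ij; rewrite !wE.
  have [pi Qi] := fS i oi; have [pj Qj] := fS j oj.
  apply: (@cnt_lt_le (fun k => pnd (x k)) _ _ pi); rewrite [X in X < _]Qi [X in _ < X]Qj.
  exact: (@cnt_lt (fun k => low (x k))).
apply: (@eq_from_nth _ None); rewrite size_word // => k kn.
pose j := Ordinal kn; rewrite (nth_word w j : nth None (word w) k = _) -[RHS]/(x j).
case E: (x j) => [[o p]|]; last by rewrite /ltr wE f0 // eqxx.
pose i := (w^-1 j)%g; have wi : w i = j by rewrite permKV.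
have wj : w j <> j.
  move=> wj; case: (tri j) => [|/wexc|/wdef]; rewrite ?E // wj ltnn //.
rewrite /ltr; case: eqP => // _; congr (Some (_, _)).
  case: o E => E; first by apply: wexc; rewrite E.
  by apply/negbTE; rewrite -leqNgt ltnW // wdef // E.
rewrite -/i; case: (tri i) => Ei.
- have ij : i = j by rewrite -[RHS]wi wE (f0 i Ei).
  by case: wj; rewrite -ij wE (f0 i Ei).
- have [+ _] := fP i Ei; rewrite -wE wi E /= => /negbTE->.
  by have := ltnW (wexc i Ei); rewrite wi leqNgt => /negbTE.
- have [+ _] := fS i Ei; rewrite -wE wi E /= => ->.
  by have := wdef i Ei; rewrite wi => ->.
Qed.

Fixpoint words (n : nat) : seq (seq letter) :=
  if n is n'.+1 then
    [seq a :: t | a <- [:: None; up; dn; lu; ll], t <- words n'] else [:: [::]].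

Lemma mem_words n s : (s \in words n) = (size s == n).
Proof.
elim: n s => [|n IH] s; first by rewrite inE size_eq0.
apply/allpairsP/idP => [[[a t] /= [_ ht ->]]|]; first by rewrite /= eqSS -IH.
case: s => //= a s; rewrite eqSS -IH => hs; exists (a, s); split=> //=.
by case: a => [[[] []]|]; rewrite !inE.
Qed.

Lemma words_uniq n : uniq (words n).
Proof.
elim: n => // n IH; rewrite [words _]/(allpairs cons _ _).
by apply: allpairs_uniq => // -[a s] [b t] _ _ /= [-> ->].
Qed.

(** Treats both families at once: with [fb] set, avoiding 4231 as well gives the freely braided
    case. *)
Definition braid_class fb n (w : 'S_n) : bool :=
  [&& maximally_clustered w, fb ==> avoids [:: 4; 2; 3; 1] w & hexagon_avoiding w].

Lemma card_braid_class fb n :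
  #|[set w : 'S_n | braid_class fb w]| = count (run fb 0 None) (words n).
Proof.
rewrite cardE -size_filter -(size_map (@word n)) /=.
have cls (w : 'S_n) : braid_class fb w =
    [&& inc_exc w, inc_def w & run fb 0 None (word w)].
  rewrite /braid_class maximally_clusteredE -!andbA.
  case He: (inc_exc w) => //=; case Hd: (inc_def w) => //=.
  by rewrite run_word.
apply/perm_size/uniq_perm.
- rewrite map_inj_in_uniq ?enum_uniq // => w w'; rewrite !mem_enum !inE !cls.
  by move=> /and3P[h1 h2 _] /and3P[h3 h4 _]; apply: word_inj.
- exact/filter_uniq/words_uniq.
move=> s; rewrite mem_filter mem_words; apply/mapP/andP.
  move=> [w]; rewrite mem_enum inE cls => /and3P[_ _ h] ->.
  by rewrite h size_word.
move=> [hs /eqP ss]; have [w [h1 h2 h3]] := word_surj ss hs.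
by exists w; rewrite // mem_enum inE cls h1 h2 h3.
Qed.

(** * Enumeration *)

Definition nruns fb h p n : nat := count (run fb h p) (words n).

Lemma nrunsS fb h p n : nruns fb h p n.+1 =
  \sum_(a <- [:: None; up; dn; lu; ll]) ok fb h p a * nruns fb (hstep h a) a n.
Proof.
rewrite /nruns [words n.+1]/(allpairs cons [:: None; up; dn; lu; ll] (words n)).
move: (words n) => ws; elim: [:: None; up; dn; lu; ll] => [|a l IH]; first by rewrite big_nil.
rewrite allpairs_cons count_cat IH big_cons; congr (_ + _).
by rewrite count_map; case E: (ok fb h p a); rewrite ?mul1n ?mul0n -?(count_pred0 ws);
  apply: eq_count => t /=; rewrite E.
Qed.

Lemma eq_nruns fb h p q n : (forall a, ok fb h p a = ok fb h q a) ->
  nruns fb h p n = nruns fb h q n.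
Proof. by move=> E; apply: eq_count => -[|a s] //=; rewrite E. Qed.

(** Eight states suffice: the previous letter matters at height 1 only for being [None], at height 2
    for being [dn], at height 3 for being [lu] or [ll]. *)
Lemma nruns_system fb n :
  let A := nruns fb 0 None in let B := nruns fb 1 up in
  let B' := nruns fb 1 None in let C := nruns fb 2 up in
  let C' := nruns fb 2 dn in let D := nruns fb 3 up in
  let U := nruns fb 3 lu in let L := nruns fb 3 ll in
  [/\ A n.+1 = A n + B n,
      B n.+1 = A n + B' n + 2 * B n + C n,
      B' n.+1 = A n + ~~ fb * B' n + 2 * B n + C n &
      [/\ C n.+1 = B n + 2 * C n + D n,
          C' n.+1 = B n + 2 * C n,
          D n.+1 = C' n + U n + L n,
          U n.+1 = C' n + U n &
          L n.+1 = C' n + L n]].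
Proof.
have e0 p : nruns fb 0 p n = nruns fb 0 None n.
  by apply: eq_nruns => -[[[] []]|]; rewrite //= andbF.
have e1 p : p != None -> nruns fb 1 p n = nruns fb 1 up n.
  by move=> /negbTE pN; apply: eq_nruns => -[[[] []]|] //=; rewrite pN.
have e2 p : p != dn -> nruns fb 2 p n = nruns fb 2 up n.
  by move=> /negbTE pN; apply: eq_nruns => -[[[] []]|] //=; rewrite pN.
move=> A B B' C C' D U L.
rewrite /A /B /B' /C /C' /D /U /L !nrunsS !unlock /= !andbF /=.
rewrite !(e0 dn) !(e1 dn) // !(e1 lu) // !(e1 ll) // !(e2 lu) // !(e2 ll) //.
by rewrite ?eqxx ?andbT; split; [ | | | split]; lia.
Qed.

(** Seven consecutive instances of the system eliminate every state but [A]; negative terms are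
    moved across to stay in [nat]. *)
Lemma nruns_fb_rec n : let A := nruns true 0 None in
  A (n + 7) + 9 * A (n + 5) + 8 * A (n + 2) + A (n + 1) =
  6 * A (n + 6) + 3 * A (n + 4) + A (n + 3) + A n.
Proof.
move=> A; rewrite !addnS addn0.
have [] := nruns_system true n; have [] := nruns_system true n.+1.
have [] := nruns_system true n.+2; have [] := nruns_system true n.+3.
have [] := nruns_system true n.+4; have [] := nruns_system true n.+4.+1.
have [] := nruns_system true n.+4.+2; rewrite /= !mul0n !addn0.
do 7![move=> ? ? ? [? ? ? ? ?]]; rewrite /A; lia.
Qed.

Lemma nruns_mc_rec n : let A := nruns false 0 None in
  A (n + 6) + 15 * A (n + 4) + 8 * A (n + 2) + 4 * A (n + 1) =
  7 * A (n + 5) + 14 * A (n + 3) + 3 * A n.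
Proof.
move=> A; rewrite !addnS addn0.
(* Without the 4231 condition a preceding fixed point is irrelevant, so two states merge and six
   instances suffice. *)
have : nruns false 1 None n = nruns false 1 up n by exact: eq_nruns.
have [] := nruns_system false n; have [] := nruns_system false n.+1.
have [] := nruns_system false n.+2; have [] := nruns_system false n.+3.
have [] := nruns_system false n.+4; have [] := nruns_system false n.+4.+1.
rewrite /= !mul1n.
do 6![move=> ? ? ? [? ? ? ? ?]]; move=> ?; rewrite /A; lia.
Qed.

(** Binary numbers and pruning of forbidden letters make the initial values computable. *)
Fixpoint nruns_bin fb h p n : BinNat.N.t :=
  if n is n'.+1 then
    foldr (fun a r => if ok fb h p a
                      then BinNat.N.add (nruns_bin fb (hstep h a) a n') r else r)
      BinNat.N.zero [:: None; up; dn; lu; ll]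
  else if h == 0 then BinNat.N.one else BinNat.N.zero.

Lemma nruns_binE fb h p n : nruns fb h p n = BinNat.N.to_nat (nruns_bin fb h p n).
Proof.
elim: n h p => [|n IH] h p; first by rewrite /nruns /=; case: (h == 0).
rewrite nrunsS -[nruns_bin _ _ _ _]/(foldr (fun a r => if ok fb h p a
  then BinNat.N.add (nruns_bin fb (hstep h a) a n) r else r)
  BinNat.N.zero [:: None; up; dn; lu; ll]).
elim: [:: None; up; dn; lu; ll] => [|a l IHl]; first by rewrite big_nil.
rewrite big_cons IH IHl /=; case: (ok fb h p a); last by rewrite mul0n add0n.
rewrite mul1n; exact: esym (Nnat.N2Nat.inj_add _ _).
Qed.

Lemma num_fb_hexE n : num_fb_hex n = nruns true 0 None n.
Proof.
rewrite /nruns -card_braid_class; apply: eq_card => w; rewrite !inE.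
rewrite /freely_braided /braid_class /maximally_clustered /=.
by do 4![case: (avoids _ w)].
Qed.

Lemma num_mc_hexE n : num_mc_hex n = nruns false 0 None n.
Proof. by rewrite /nruns -card_braid_class; apply: eq_card => w; rewrite !inE. Qed.

Local Open Scope ring_scope.

Theorem corollary2p7 :
  let b (n : nat) : int := (num_fb_hex n)%:Z in
  let m (n : nat) : int := (num_mc_hex n)%:Z in
  (forall n : nat, (9 <= n)%N ->
     b (n + 1)%N = 6 * b n - 9 * b (n - 1)%N + 3 * b (n - 2)%N + b (n - 3)%N
                   - 8 * b (n - 4)%N - b (n - 5)%N + b (n - 6)%N
  /\ m (n + 1)%N = 7 * m n - 15 * m (n - 1)%N + 14 * m (n - 2)%N
                   - 8 * m (n - 3)%N - 4 * m (n - 4)%N + 3 * m (n - 5)%N)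
  /\ [seq b i | i <- iota 3 7] = [:: 6; 20; 71; 260; 971; 3670; 13968]
  /\ [seq m i | i <- iota 3 7] = [:: 6; 21; 78; 298; 1157; 4535; 17872].
Proof.
move=> b m; split; last first.
  rewrite /b /m /= !num_fb_hexE !num_mc_hexE !nruns_binE.
  by vm_compute (nruns_bin _ _ _ _); split; congr [:: _; _; _; _; _; _; _]; lia.
move=> n n9; have [k ->] : exists k, n = (k + 6)%N by exists (n - 6)%N; lia.
rewrite /b /m !num_fb_hexE !num_mc_hexE.
(* The second recurrence has order 6 instead of 7, so it is taken one index later. *)
have := nruns_fb_rec k; have := nruns_mc_rec k.+1.
rewrite (_ : k + 6 + 1 = k + 7)%N; last by lia.
rewrite (_ : k + 6 - 1 = k + 5)%N; last by lia.
rewrite (_ : k + 6 - 2 = k + 4)%N; last by lia.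
rewrite (_ : k + 6 - 3 = k + 3)%N; last by lia.
rewrite (_ : k + 6 - 4 = k + 2)%N; last by lia.
rewrite (_ : k + 6 - 5 = k + 1)%N; last by lia.
rewrite addnK !addSnnS -[k.+1]addn1.
clear; move=> E1 E2; split; lia.
Qed.
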